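(* Let $G=(S,T,\pi)$ be a two-person win-lose game (with $S,T$ arbitrary non-empty sets). Then $G$ is totally minimax if and only if $G$ is LNG-free.
   Context: A two-person win-lose game is a triple $G=(S,T,\pi)$ where $S,T$ are non-empty sets (possibly infinite, of any cardinality) and $\pi:S\times T\to\{0,1\}$. For a set $X$, $\Delta(X)$ denotes the set of probability distributions $\mathbf{p}=(p_x)_{x\in X}$ on $X$ with at most countable support. For $\mathbf{p}\in\Delta(S)$, $\mathbf{q}\in\Delta(T)$, $\pi^{\mathrm{mix}}(\mathbf{p},\mathbf{q})=\sum_{s,t}p_sq_t\pi(s,t)$. $G$ satisfies the minimax property if $\sup_{\mathbf{p}\in\Delta(S)}\inf_{\mathbf{q}\in\Delta(T)}\pi^{\mathrm{mix}}(\mathbf{p},\mathbf{q})=\inf_{\mathbf{q}\in\Delta(T)}\sup_{\mathbf{p}\in\Delta(S)}\pi^{\mathrm{mix}}(\mathbf{p},\mathbf{q})$. A subgame of $G$ is a game $(S',T',\pi')$ with non-empty $S'\subseteq S$, $T'\subseteq T$ and $\pi'=\pi|_{S'\times T'}$. $G$ is totally minimax if every subgame of $G$ satisfies the minimax property. The larger number game (LNG) is $(\mathbb{N},\mathbb{N},\pi)$ with $\pi(s,t)=1$ iff $s\ge t$. $G$ is LNG-free if no subgame of $G$ is isomorphic to LNG, i.e., there are no sequences $s_1,s_2,\ldots$ in $S$ and $t_1,t_2,\ldots$ in $T$ (each consisting of distinct elements) with $\pi(s_i,t_j)=1\iff i\ge j$. *)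

(* Defs.v *)
From HB Require Import structures.
From mathcomp Require Import all_boot all_order all_algebra.
From mathcomp Require Import all_classical all_reals.
From mathcomp Require Import ereal esum.
From mathcomp Require Import Rstruct.
From Stdlib Require Import Reals.

Set Implicit Arguments.
Unset Strict Implicit.
Unset Printing Implicit Defensive.

Import Order.TTheory GRing.Theory Num.Theory.
Local Open Scope classical_set_scope.
Local Open Scope ring_scope.
Local Open Scope ereal_scope.
Delimit Scope nat_scope with nat.

(* A two-person win-lose game (S, T, pi) is given by arbitrary types S, T
   and a payoff pi : S -> T -> bool (true = 1, false = 0). *)

(* Delta(X): probability distributions on X with at most countable support.
   Sums over arbitrary index sets are the (extended-real) unordered sums
   esum, which is the standard notion for nonnegative families. *)
Definition distr (X : Type) (p : X -> R) : Prop :=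
  (forall x, (0 <= p x)%R) /\
  countable [set x | p x != 0%R] /\
  \esum_(x in [set: {classic X}]) (p x)%:E = 1.

Definition pimix (S T : Type) (pi : S -> T -> bool) (p : S -> R) (q : T -> R)
  : \bar R :=
  \esum_(st in [set: {classic (S * T)%type}])
     ((p st.1 * q st.2 * (pi st.1 st.2)%:R)%R)%:E.

Definition minimax (S T : Type) (pi : S -> T -> bool) : Prop :=
  ereal_sup [set ereal_inf [set pimix pi p q | q in @distr T] | p in @distr S]
  = ereal_inf [set ereal_sup [set pimix pi p q | p in @distr S] | q in @distr T].

Definition subgame (S T : Type) (pi : S -> T -> bool) (A : set S) (B : set T)
  : {x : S | A x} -> {y : T | B y} -> bool :=
  fun s t => pi (proj1_sig s) (proj1_sig t).

Definition totally_minimax (S T : Type) (pi : S -> T -> bool) : Prop :=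
  forall (A : set S) (B : set T), A !=set0 -> B !=set0 ->
    minimax (@subgame S T pi A B).

Definition LNG_free (S T : Type) (pi : S -> T -> bool) : Prop :=
  ~ exists (s : nat -> S) (t : nat -> T),
      injective s /\ injective t /\
      forall i j : nat, pi (s i) (t j) = (j <= i)%nat.

(* Main.v *)
From Stdlib Require Import Rdefinitions.
Require Import Defs.
From mathcomp Require Import all_boot all_order all_algebra.
From mathcomp Require Import all_classical all_reals.
From mathcomp Require Import ereal esum Rstruct.
From mathcomp Require Import ring lra.

Set Implicit Arguments.
Unset Strict Implicit.
Unset Printing Implicit Defensive.

Import Order.TTheory GRing.Theory Num.Theory.
Local Open Scope classical_set_scope.
Local Open Scope ring_scope.

(** In the LNG every mixed strategy has small tails, so the two values are 0
    and 1. Conversely, let [v < a < b < w] separate the values of an LNG-free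
    game. The finite minimax theorem yields, for each finite set of rows, a
    finitely supported [q] which every one of these rows meets with probability
    at most [a], and, for each finite set of columns, a finitely supported [p]
    which meets each of them with probability at least [b]. Alternating the two
    gives sequences [p_n], [q_n], where [p_i] meets [q_j] with probability at
    least [b] for [j <= i] and at most [a] for [i < j]: a larger number game
    with mixed strategies. It is made pure in two rounds, first in the rows and
    then in the columns. Each round rests on one principle: along an ultrafilter
    on [nat], a sequence of events of probability bounded below has an infinite
    subsequence with nonempty finite intersections, and each next event can be
    picked in a set of indices of the ultrafilter. *)

(** * Frequencies in finite lists *)

(** A list stands for the mixed strategy that draws a uniformly random entry, repetitions counted.
    The empty list gives frequency 0. *)
Definition freq (R : realType) (X : Type) (l : seq X) (A : pred X) : R :=
  (count A l)%:R / (size l)%:R.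

Lemma freq_ge0 (R : realType) (X : Type) (l : seq X) (A : pred X) :
  0 <= freq R l A.
Proof. by rewrite divr_ge0. Qed.

Lemma freq_le1 (R : realType) (X : Type) (l : seq X) (A : pred X) :
  freq R l A <= 1.
Proof.
case: l => [|x l]; first by rewrite /freq mul0r.
by rewrite ler_pdivrMr ?ltr0n// mul1r ler_nat count_size.
Qed.

Lemma eq_in_freq (R : realType) (X : eqType) (l : seq X) (A B : pred X) :
  {in l, A =1 B} -> freq R l A = freq R l B.
Proof. by move=> AB; rewrite /freq (eq_in_count AB). Qed.

Lemma freqUI (R : realType) (X : Type) (l : seq X) (A B : pred X) :
  freq R l (predU A B) + freq R l (predI A B) = freq R l A + freq R l B.
Proof. by rewrite /freq -!mulrDl -!natrD count_predUI. Qed.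

Lemma freq_sub (R : realType) (X : Type) (l : seq X) (A B : pred X) :
  subpred A B -> freq R l A <= freq R l B.
Proof. by move=> AB; rewrite ler_wpM2r ?invr_ge0// ler_nat sub_count. Qed.

Lemma freq_gt0P (R : realType) (X : eqType) (l : seq X) (A : pred X) :
  0 < freq R l A -> exists2 x, x \in l & A x.
Proof.
have [/hasP//|/negbTE hA] := boolP (has A l).
by rewrite /freq; move: hA; rewrite has_count lt0n => /negbFE/eqP ->;
  rewrite mul0r ltxx.
Qed.

Lemma freqC (R : realType) (X : Type) (l : seq X) (A : pred X) :
  (0 < size l)%N -> freq R l (predC A) = 1 - freq R l A.
Proof.
move=> l0; have l0' : (size l)%:R != 0 :> R by rewrite pnatr_eq0 -lt0n.
rewrite -(divff l0') /freq -mulrBl -(count_predC A l) natrD.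
by congr (_ / _); rewrite addrC addKr.
Qed.

Lemma freq_has_le (R : realType) (X : Type) (I : eqType) (l : seq X)
    (B : pred X) (A : I -> pred X) (js : seq I) (d : R) :
  (forall j, j \in js -> freq R l (predI B (A j)) <= d) ->
  freq R l [pred x | B x && has (A^~ x) js] <= (size js)%:R * d.
Proof.
elim: js => [|j js IH] H.
  rewrite mul0r /freq (eq_count (a2 := pred0)) ?count_pred0 ?mul0r//.
  by move=> x /=; rewrite andbF.
have := freqUI R l (predI B (A j)) [pred x | B x && has (A^~ x) js].
have := freq_ge0 R l (predI (predI B (A j)) [pred x | B x && has (A^~ x) js]).
have := IH (fun i ijs => H i (@mem_behead _ (j :: js) i ijs)).
have := H j (mem_head _ _).
have : freq R l [pred x | B x && has (A^~ x) (j :: js)] <=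
   freq R l (predU (predI B (A j)) [pred x | B x && has (A^~ x) js]).
  by apply: freq_sub => x /=; case: (B x).
rewrite [size (_ :: _)]/= mulrSr mulrDl mul1r; lra.
Qed.

Lemma freq_sum (R : realType) (X : Type) (l : seq X) (A : pred X) :
  freq R l A = (\sum_(x <- l) (A x)%:R) / (size l)%:R.
Proof.
rewrite /freq; congr (_ / _).
by elim: l => [|x l IH]; rewrite ?big_nil//= big_cons natrD IH.
Qed.

(** Double counting: the average over [q] of the column frequencies is the average over [p] of the
    row frequencies, and a row frequency, being at most 1, is at most [c] plus the indicator of the
    good rows. *)
Lemma freq_markov (R : realType) (S T : eqType) (pi : S -> T -> bool)
    (p : seq S) (q : seq T) (b c : R) :
  (0 < size p)%N -> (0 < size q)%N -> 0 <= c ->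
  (forall t, t \in q -> b <= freq R p (pi^~ t)) ->
  b <= c + freq R p [pred s | c <= freq R q (pi s)].
Proof.
move=> p0 q0 c0 H.
have P0 : (0 : R) < (size p)%:R by rewrite ltr0n.
have Q0 : (0 : R) < (size q)%:R by rewrite ltr0n.
have h1 : b * (size q)%:R <= \sum_(t <- q) freq R p (pi^~ t).
  rewrite mulr_natr -[X in _ *+ X](count_predT q) -iter_addr_0 -big_const_seq.
  by rewrite big_seq [leRHS]big_seq; apply: ler_sum => t /H.
have h2 : \sum_(t <- q) freq R p (pi^~ t) =
    (\sum_(s <- p) freq R q (pi s)) * (size q)%:R / (size p)%:R.
  rewrite mulr_suml; under eq_bigr do rewrite freq_sum.
  under [in RHS]eq_bigr do rewrite freq_sum divfK ?gt_eqF//.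
  by rewrite -mulr_suml exchange_big.
have h3 : \sum_(s <- p) freq R q (pi s) <=
    \sum_(s <- p) (c + (c <= freq R q (pi s))%R%:R).
  apply: ler_sum => s _; have := freq_le1 R q (pi s).
  by case: (leP c (freq R q (pi s))) => /=; lra.
rewrite h2 -mulrA [_ / _]mulrC mulrA ler_pM2r// ler_pdivlMr// in h1.
apply: (@le_trans _ _ ((\sum_(s <- p) freq R q (pi s)) / (size p)%:R)).
  by rewrite ler_pdivlMr.
rewrite ler_pdivrMr// (le_trans h3)// big_split/= freq_sum mulrDl divfK ?gt_eqF//.
by rewrite big_const_seq count_predT iter_addr_0 mulr_natr.
Qed.

(** * Finite minimax theorem *)

(** Blackwell approachability: answering the positive parts of the regrets keeps
    their squared norm linear in the number of rounds. *)
Lemma finite_minimax (R : realType) (S T : eqType) (pi : S -> T -> bool)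
    (a e : R) (E : seq S) : 0 < e ->
  (forall w : S -> R, (forall s, 0 <= w s) ->
    exists t, \sum_(s <- E) w s * (pi s t)%:R <= a * \sum_(s <- E) w s) ->
  exists2 q : seq T, (0 < size q)%N &
    forall s, s \in E -> freq R q (pi s) <= a + e.
Proof.
move=> e0 H.
(* [x q s] counts the hits of row [s] beyond the allowed rate [a]; [C] bounds the sum over [E] of
   the squared one-round changes. *)
pose x (q : seq T) s : R := (count (pi s) q)%:R - a * (size q)%:R.
pose C : R := (size E)%:R * (1 + `|a|) ^+ 2.
have key N : exists2 q : seq T, size q = N &
    \sum_(s <- E) Num.max 0 (x q s) ^+ 2 <= N%:R * C.
  elim: N => [|N [q sq Hq]].
    exists [::] => //; rewrite mul0r big1// => s _.
    by rewrite /x /= mulr0 subr0 maxxx expr0n.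
  (* Weighting rows by their positive regrets makes the cross term of the expanded squares
     nonpositive. *)
  have [|t Ht] := H (fun s => Num.max 0 (x q s)).
    by move=> s; rewrite le_max lexx.
  exists (t :: q); first by rewrite /= sq.
  apply: (@le_trans _ _ (\sum_(s <- E) (Num.max 0 (x q s) ^+ 2 +
     2 * (Num.max 0 (x q s) * (pi s t)%:R - a * Num.max 0 (x q s)) +
     (1 + `|a|) ^+ 2))).
    apply: ler_sum => s _.
    have -> : x (t :: q) s = x q s + ((pi s t)%:R - a).
      by rewrite /x /= natrD -natr1; lra.
    move: (x q s) => y.
    have d2 : ((pi s t)%:R - a) ^+ 2 <= (1 + `|a|) ^+ 2.
      have := ler_norm a; have := ler_norm (- a); rewrite normrN.
      by case: (pi s t) => /= n1 n2; nra.
    move: ((pi s t)%:R) d2 => u d2; rewrite !maxEle.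
    by case: (leP 0 y) => h1; case: (leP 0 (y + (u - a))) => h2;
      have := sqr_ge0 (y + (u - a)); have := sqr_ge0 (u - a); nra.
  rewrite !big_split/= -mulr_sumr sumrB -mulr_sumr.
  rewrite big_const_seq count_predT iter_addr_0.
  rewrite -/C mulrSr mulrDl mul1r.
  have -> : (1 + `|a|) ^+ 2 *+ size E = C by rewrite /C mulr_natl.
  lra.
have [N HN] : exists N, C / e ^+ 2 < N.+1%:R.
  exists (Num.truncn (C / e ^+ 2)); exact: truncnS_gt.
have [q sq Hq] := key N.+1.
exists q => [|s sE]; first by rewrite sq.
have N0 : (0 : R) < N.+1%:R by rewrite ltr0n.
rewrite ler_pdivrMr sq// leNgt; apply/negP => hs.
have hx : e * N.+1%:R < x q s by rewrite /x sq; lra.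
have h1 : (x q s) ^+ 2 <= N.+1%:R * C.
  apply: le_trans Hq; rewrite (big_rem s)//=.
  rewrite (max_idPr _); last by nra.
  by rewrite lerDl sumr_ge0// => i _; rewrite sqr_ge0.
rewrite ltr_pdivrMr ?exprn_gt0// in HN.
have h2 : (e * N.+1%:R) ^+ 2 < (x q s) ^+ 2.
  by rewrite ltr_pXn2r ?nnegrE//; nra.
nra.
Qed.

(** * Greedy selection along an ultrafilter *)

(** Dependent choice with memory: [inv] keeps a prefix extendible, [step] records what a new term
    owes to the earlier ones. *)
Lemma greedy_sequence (X : Type) (inv : seq X -> Prop)
    (step : seq X -> X -> Prop) :
  inv [::] ->
  (forall l, inv l -> exists2 x, step l x & inv (rcons l x)) ->
  exists f : nat -> X, forall n, step (mkseq f n) (f n).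
Proof.
move=> inv0 H.
have [x0 _ _] := H _ inv0.
have /choice[g gP] : forall l, exists x, inv l -> step l x /\ inv (rcons l x).
  move=> l; have [/H[x ? ?]|nl] := pselect (inv l); first by exists x.
  by exists x0.
pose h := fix h n := if n is m.+1 then rcons (h m) (g (h m)) else [::].
exists (fun n => g (h n)) => n.
have hE m : mkseq (fun k => g (h k)) m = h m.
  by elim: m => //= m IH; rewrite mkseqS IH.
have hinv m : inv (h m) by elim: m => //= m /gP[].
by rewrite hE; have [] := gP _ (hinv n).
Qed.

Lemma filter_in_seq (I : Type) (J : eqType) (F : set_system I) (s : seq J)
    (A : J -> set I) : Filter F ->
  (forall j, j \in s -> F (A j)) -> F [set i | forall j, j \in s -> A j i].
Proof.
move=> FF; elim: s => [|j s IH] H; first exact: filterE.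
have Fs : F [set i | forall k, k \in s -> A k i].
  by apply: IH => k ks; apply: H; rewrite in_cons ks orbT.
apply: filterS (filterI (H j (mem_head _ _)) Fs) => i [Aj As] k.
by rewrite in_cons => /predU1P[->//|/As].
Qed.

(** The events [A j], [j] in [js], can be extended by [U]-many further events so
    that the intersection keeps probability at least [d] under [U]-many [p n]. *)
Definition persistent (R : realType) (U : set_system nat) (X : Type)
    (p : nat -> seq X) (A : nat -> pred X) (js : seq nat) : Prop :=
  exists2 d : R, 0 < d &
    U [set j | U [set n | d <= freq R (p n) [pred x | all (A^~ x) (rcons js j)]]].

(** Were this false, [U]-many indices from the witness set of [persistent] would fail to extend, and
    the ultrafilter dichotomy turns each failure into negligible overlaps. *)
Lemma persistent_rcons (R : realType) (U : set_system nat) (X : eqType)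
    (p : nat -> seq X) (A : nat -> pred X) (js : seq nat) :
  UltraFilter U -> persistent R U p A js ->
  U [set j | persistent R U p A (rcons js j)].
Proof.
move=> UU [d d0 Hd]; set G := [set j | _].
have [//|UG] := in_ultra_setVsetC G UU; exfalso.
pose B : pred X := [pred x | all (A^~ x) js].
have BE n j : freq R (p n) [pred x | all (A^~ x) (rcons js j)] =
    freq R (p n) (predI B (A j)).
  by apply: eq_in_freq => x _; rewrite /= all_rcons andbC.
have UF : Filter U by exact: _.
have UJ := @filterI _ _ UF _ _ Hd UG; set J := _ `&` _ in UJ.
have small j e : ~ persistent R U p A (rcons js j) -> 0 < e ->
    U [set k | U [set n | freq R (p n) (predI (predI B (A k)) (A j)) <= e]].
  move=> nb e0.
  have [Ub|] := in_ultra_setVsetC [set k | U [set n |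
    e <= freq R (p n) [pred x | all (A^~ x) (rcons (rcons js j) k)]]] UU.
    by exfalso; apply: nb; exists e.
  move=> Uc; apply: filterS Uc => k /= nU.
  have [//|] := in_ultra_setVsetC [set n |
    e <= freq R (p n) [pred x | all (A^~ x) (rcons (rcons js j) k)]] UU.
  move=> Uc; apply: filterS Uc => n /= /negP; rewrite -ltNge => /ltW.
  apply: le_trans.
  by apply: freq_sub => x; rewrite /= !all_rcons => /andP[/andP[Bx ->] ->].
(* Indices that cannot be appended give almost disjoint events, whose union
   would have probability at least [N * (d / 2)] for every [N]. *)
have key N : exists ks : seq nat, [/\ size ks = N, (forall k, k \in ks -> J k) &
    U [set n | N%:R * (d / 2) <= freq R (p n) [pred x | B x && has (A^~ x) ks]]].
  elim: N => [|N [ks [sks ksJ Uks]]].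
    exists [::]; split => //; apply: filterE => n /=.
    by rewrite mul0r freq_ge0.
  (* The [N] overlaps, each of probability at most [e], cost at most [d / 2], so the new event adds
     at least [d / 2]. *)
  pose e : R := d / (2 * N.+1%:R).
  have N0 : (0 : R) < N.+1%:R by rewrite ltr0n.
  have e0 : 0 < e by rewrite divr_gt0// mulr_gt0.
  have /filter_ex[k [Jk Hk]] : U (J `&` [set k | forall j, j \in ks ->
      U [set n | freq R (p n) (predI (predI B (A k)) (A j)) <= e]]).
    apply: filterI => //.
    by apply: filter_in_seq => j /ksJ[_ nb]; exact: small.
  exists (k :: ks); split => /=; first by rewrite sks.
    by move=> j; rewrite in_cons => /predU1P[->//|/ksJ].
  have Uk := Jk.1.
  have {}Hk := filter_in_seq UF Hk.
  apply: filterS (filterI Uks (filterI Uk Hk)) => n [/= h1 [h2 h3]].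
  rewrite BE in h2.
  have h4 := freq_has_le h3; rewrite sks in h4.
  have h5 := freqUI R (p n) (predI B (A k)) [pred x | B x && has (A^~ x) ks].
  have h6 : freq R (p n) (predI (predI B (A k)) [pred x | B x && has (A^~ x) ks])
     <= freq R (p n) [pred x | predI B (A k) x && has (A^~ x) ks].
    by apply: freq_sub => x /= /andP[-> /andP[_ ->]].
  have h7 : freq R (p n) (predU (predI B (A k)) [pred x | B x && has (A^~ x) ks])
     <= freq R (p n) [pred x | B x && (A k x || has (A^~ x) ks)].
    by apply: freq_sub => x /=; case: (B x).
  have h8 : N%:R * e <= d / 2.
    have : N.+1%:R * e = d / 2.
      by rewrite /e; move: (N.+1%:R) N0 => M M0; field; rewrite gt_eqF.
    by rewrite -natr1; nra.
  by rewrite -natr1; lra.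
have [ks [_ _ /filter_ex[n /=]]] := key (Num.truncn (d / 2)^-1).+1.
have := truncnS_gt (d / 2)^-1.
have := freq_le1 R (p n) [pred x | B x && has (A^~ x) ks].
set N : R := _.+1%:R => f1 N1 f2.
have d20 : 0 < d / 2 by rewrite divr_gt0.
have : 1 < N * (d / 2) by rewrite -ltr_pdivrMr// mul1r.
lra.
Qed.

Lemma persistent_ex (R : realType) (U : set_system nat) (X : eqType)
    (p : nat -> seq X) (A : nat -> pred X) (js : seq nat) :
  ProperFilter U -> persistent R U p A js ->
  exists n x, x \in p n /\ forall j, j \in js -> A j x.
Proof.
move=> UU [d d0 /filter_ex[j /filter_ex[n /= /(lt_le_trans d0)]]].
move=> /freq_gt0P[x xp /allP Hx]; exists n, x; split => // k kjs.
by apply: Hx; rewrite mem_rcons in_cons kjs orbT.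
Qed.

Lemma exists_nonprincipal_ultrafilter :
  exists2 U : set_system nat, UltraFilter U &
    forall n, U [set m | (n < m)%N].
Proof.
have [U [UU leU]] := ultraFilterLemma eventually_filter.
by exists U => // n; apply: leU; exists n.+1.
Qed.

(** * Extraction of a pure larger number game *)

Lemma mem_mkseq_nat (X : eqType) (f : nat -> X) (i n : nat) :
  (i < n)%N -> f i \in mkseq f n.
Proof. by move=> lin; apply: map_f; rewrite mem_iota. Qed.

(** In each round [q] is chosen first, against the rows of all earlier [p]; then [p] answers all
    columns so far, including those of the new [q]. Hence one index inequality is strict and the
    other is not. *)
Lemma alternating_responses (R : realType) (S T : eqType)
    (pi : S -> T -> bool) (a b : R) :
  (forall E : seq S, exists2 q : seq T, (0 < size q)%N &
    forall s, s \in E -> freq R q (pi s) <= a) ->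
  (forall F : seq T, exists2 p : seq S, (0 < size p)%N &
    forall t, t \in F -> b <= freq R p (pi^~ t)) ->
  exists (p : nat -> seq S) (q : nat -> seq T),
    [/\ forall n, (0 < size (p n))%N, forall n, (0 < size (q n))%N,
        forall i j, (i < j)%N ->
          forall s, s \in p i -> freq R (q j) (pi s) <= a &
        forall i j, (j <= i)%N ->
          forall t, t \in q j -> b <= freq R (p i) (pi^~ t)].
Proof.
move=> Hq Hp.
have [//|l _|f fP] := @greedy_sequence (seq S * seq T) (fun _ => True)
  (fun l x => [/\ (0 < size x.1)%N, (0 < size x.2)%N,
     forall y, y \in l -> forall s, s \in y.1 -> freq R x.2 (pi s) <= a &
     forall y, y \in x :: l -> forall t, t \in y.2 -> b <= freq R x.1 (pi^~ t)]).
  have [q q0 qP] := Hq (flatten [seq y.1 | y <- l]).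
  have [p p0 pP] := Hp (q ++ flatten [seq y.2 | y <- l]).
  exists (p, q) => //; split => //= y.
    by move=> yl s sy; apply: qP; apply/flatten_mapP; exists y.
  rewrite in_cons => /predU1P[->|yl] t ty; apply: pP; rewrite mem_cat ?ty//.
  by apply/orP; right; apply/flatten_mapP; exists y.
exists (fun n => (f n).1), (fun n => (f n).2).
split=> [n|n|i j ij s si|i j ji t tj]; try by have [] := fP n.
  by have [_ _ + _] := fP j; apply; [exact: mem_mkseq_nat ij|].
have [_ _ _ Hi] := fP i; apply: Hi tj.
move: ji; rewrite leq_eqVlt => /predU1P[->|ji]; first exact: mem_head.
by rewrite in_cons mem_mkseq_nat ?orbT.
Qed.

Lemma persistent_nil (R : realType) (U : set_system nat) (X : Type)
    (p : nat -> seq X) (A : nat -> pred X) (d : R) :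
  Filter U -> (forall n, U [set m | (n < m)%N]) -> 0 < d ->
  (forall i n, (i < n)%N -> d <= freq R (p n) (A i)) ->
  persistent R U p A [::].
Proof.
move=> UF Uoo d0 H; exists d => //; apply: filterE => j /=.
apply: filterS (Uoo j) => n /= /H/le_trans; apply.
by apply: freq_sub => x /= ->.
Qed.

(** By [freq_markov], for [j <= n] the rows meeting [q j] with frequency at least [c] have
    probability at least [b - c] under [p n]. Selection finds one row good for all chosen [j]; the
    next [j] is taken so late that [q j] holds the earlier rows down to [a]. *)
Lemma purify_rows (R : realType) (S T : eqType) (pi : S -> T -> bool)
    (a b c : R) (p : nat -> seq S) (q : nat -> seq T) :
  0 <= c -> c < b ->
  (forall n, (0 < size (p n))%N) -> (forall n, (0 < size (q n))%N) ->
  (forall i j, (i < j)%N -> forall s, s \in p i -> freq R (q j) (pi s) <= a) ->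
  (forall i j, (j <= i)%N -> forall t, t \in q j -> b <= freq R (p i) (pi^~ t)) ->
  exists (s : nat -> S) (q' : nat -> seq T),
    (forall i j, (i < j)%N -> freq R (q' j) (pi (s i)) <= a) /\
    (forall i j, (j <= i)%N -> c <= freq R (q' j) (pi (s i))).
Proof.
move=> c0 cb p0 q0 Ha Hb.
have [U UU Uoo] := exists_nonprincipal_ultrafilter.
have UF : Filter U by exact: _.
pose A j : pred S := [pred s | c <= freq R (q j) (pi s)].
(* The second invariant remembers that each row lies in some [p n]; every [q j] with [n < j] then
   answers it. *)
have [||f fP] := @greedy_sequence (nat * S)
  (fun l => persistent R U p A [seq y.1 | y <- l] /\
     forall y, y \in l -> exists n, y.2 \in p n)
  (fun l x => (forall y, y \in l -> freq R (q x.1) (pi y.2) <= a) /\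
     (forall y, y \in x :: l -> A y.1 x.2)).
- split => //; apply: (@persistent_nil _ _ _ _ _ (b - c)) => //.
    by rewrite subr_gt0.
  move=> j n /ltnW jn; rewrite lerBlDl.
  by apply: freq_markov => // t; exact: Hb.
- move=> l [lU lp].
  have /filter_ex[j [Uj Hj]] :
      U ([set j | persistent R U p A (rcons [seq y.1 | y <- l] j)] `&`
         [set j | forall y, y \in l -> freq R (q j) (pi y.2) <= a]).
    apply: filterI; first exact: persistent_rcons.
    apply: filter_in_seq => y /lp[n yn].
    by apply: filterS (Uoo n) => j nj; exact: Ha yn.
  have [n [s [sn sA]]] := persistent_ex _ Uj.
  exists (j, s); split => //=.
  + move=> y; rewrite in_cons => /predU1P[->|yl]; apply: sA.
      by rewrite mem_rcons mem_head.
    by rewrite mem_rcons in_cons map_f ?orbT.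
  + by rewrite map_rcons.
  + move=> y; rewrite mem_rcons in_cons => /predU1P[->|/lp//].
    by exists n.
exists (fun n => (f n).2), (fun n => q (f n).1); split=> i j ij.
  by have [+ _] := fP j; apply; exact: mem_mkseq_nat ij.
have [_] := fP i; apply.
move: ij; rewrite leq_eqVlt => /predU1P[->|ij]; first exact: mem_head.
by rewrite in_cons mem_mkseq_nat ?orbT.
Qed.

(** The columns of the limit row that row [i] misses have frequency at least [c - a] in [q n] for
    [i < n]. A column of the limit row is met by [U]-many rows, so the next row can meet all earlier
    columns, while the new column avoids all chosen rows. *)
Lemma purify_columns (R : realType) (S T : eqType) (pi : S -> T -> bool)
    (a c : R) (s : nat -> S) (q : nat -> seq T) :
  a < c ->
  (forall i j, (i < j)%N -> freq R (q j) (pi (s i)) <= a) ->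
  (forall i j, (j <= i)%N -> c <= freq R (q j) (pi (s i))) ->
  exists (s' : nat -> S) (t : nat -> T),
    forall i j, pi (s' i) (t j) = (j <= i)%N.
Proof.
move=> ac Ha Hc.
have [U UU Uoo] := exists_nonprincipal_ultrafilter.
have UF : Filter U by exact: _.
(* [L] is the limit row of the sequence [s] along [U]. *)
pose L : pred T := [pred t | `[< U [set i | pi (s i) t] >]].
pose A i : pred T := [pred t | L t && ~~ pi (s i) t].
have LE t : U [set i | pi (s i) t = L t].
  have [Ut|nUt] := pselect (U [set i | pi (s i) t]).
    have Lt := Ut; apply: filterS Ut => i /= ->; exact/esym/asboolP.
  have [//|Ut] := in_ultra_setVsetC [set i | pi (s i) t] UU.
  by apply: filterS Ut => i /= /negP/negbTE ->; apply/esym/asboolPn.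
(* On the finite list [q n], some row [s i] with [n < i] agrees with [L], which inherits its bound
   [c]. *)
have Lc n : c <= freq R (q n) L.
  have /filter_ex[i [ni HL]] : U ([set i | (n < i)%N] `&`
      [set i | forall t, t \in q n -> pi (s i) t = L t]).
    apply: filterI => //.
    by apply: (@filter_in_seq _ _ _ _ (fun t => [set i | pi (s i) t = L t])).
  by rewrite -(eq_in_freq R HL) Hc// ltnW.
have [||f fP] := @greedy_sequence (nat * T)
  (fun l => persistent R U q A [seq y.1 | y <- l] /\
     forall y, y \in l -> L y.2)
  (fun l x => (forall y, y \in l -> pi (s x.1) y.2) /\
     (forall y, y \in x :: l -> ~~ pi (s y.1) x.2)).
- split => //; apply: (@persistent_nil _ _ _ _ _ (c - a)) => //.
    by rewrite subr_gt0.
  move=> i n lin.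
  have h1 := freqUI R (q n) (A i) (pi (s i)).
  have h2 := freq_ge0 R (q n) (predI (A i) (pi (s i))).
  have h3 : freq R (q n) L <= freq R (q n) (predU (A i) (pi (s i))).
    apply: freq_sub => t Lt; apply/orP.
    by case: (boolP (pi (s i) t)) => [|npi]; [right|left; apply/andP].
  have := Lc n; have := Ha _ _ lin; lra.
- move=> l [lU lL].
  have /filter_ex[i [Ui Hi]] :
      U ([set i | persistent R U q A (rcons [seq y.1 | y <- l] i)] `&`
         [set i | forall y, y \in l -> pi (s i) y.2]).
    apply: filterI; first exact: persistent_rcons.
    apply: (@filter_in_seq _ _ _ _ (fun y => [set i | pi (s i) y.2])) => y /lL.
    by move/asboolP.
  have [n [t [_ tA]]] := persistent_ex _ Ui.
  have At y : y \in (i, t) :: l -> A y.1 t.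
    rewrite in_cons => /predU1P[->|yl]; apply: tA.
      by rewrite mem_rcons mem_head.
    by rewrite mem_rcons in_cons map_f ?orbT.
  exists (i, t); split => //=.
  + by move=> y /At/andP[].
  + by rewrite map_rcons.
  + move=> y; rewrite mem_rcons in_cons => /predU1P[->|/lL//].
    by have /andP[] := At (i, t) (mem_head _ _).
(* The greedy pattern is strict ([j < i]); shifting the rows makes it [j <= i]. *)
exists (fun n => s (f n.+1).1), (fun n => (f n).2) => i j.
have [ji|ij] := leqP j i.
  have [+ _] := fP i.+1; apply; exact: mem_mkseq_nat.
apply/negbTE; have [_] := fP j; apply.
move: ij; rewrite leq_eqVlt => /predU1P[->|ij]; first exact: mem_head.
by rewrite in_cons mem_mkseq_nat ?orbT.
Qed.

Lemma LNG_pattern_of_gap (R : realType) (S T : eqType)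
    (pi : S -> T -> bool) (a b : R) : a < b ->
  (forall E : seq S, exists2 q : seq T, (0 < size q)%N &
    forall s, s \in E -> freq R q (pi s) <= a) ->
  (forall F : seq T, exists2 p : seq S, (0 < size p)%N &
    forall t, t \in F -> b <= freq R p (pi^~ t)) ->
  exists (s : nat -> S) (t : nat -> T),
    forall i j, pi (s i) (t j) = (j <= i)%N.
Proof.
move=> ab Hq Hp.
have [p [q [p0 q0 Ha Hb]]] := alternating_responses Hq Hp.
(* Makes the threshold [c] below nonnegative, as [freq_markov] requires. *)
have a0 : 0 <= a.
  have /hasP[s sp _] : has predT (p 0%N) by rewrite has_predT.
  exact: le_trans (freq_ge0 R (q 1%N) (pi s)) (Ha 0%N 1%N isT s sp).
(* Purifying the rows uses the room between [c] and [b], purifying the columns that between [a] and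
   [c]. *)
pose c := (a + b) / 2.
have ac : a < c by rewrite /c; lra.
have cb : c < b by rewrite /c; lra.
have [s [q' [Ha' Hc]]] := purify_rows (le_trans a0 (ltW ac)) cb p0 q0 Ha Hb.
exact: purify_columns ac Ha' Hc.
Qed.

Lemma LNG_pattern_inj (S T : Type) (pi : S -> T -> bool) s t :
  (forall i j : nat, pi (s i) (t j) = (j <= i)%N) -> injective s /\ injective t.
Proof.
move=> H; split=> i j ij; apply/eqP; rewrite eqn_leq; apply/andP; split.
- by rewrite -H -ij H.
- by rewrite -H ij H.
- by rewrite -H ij H.
- by rewrite -H -ij H.
Qed.

(** * Unordered sums in the extended reals *)

Lemma esum_seq (R : realType) (X : choiceType) (E : seq X) (f : X -> \bar R) :
  uniq E -> (forall x, 0 <= f x)%E -> (forall x, x \notin E -> f x = 0%E) ->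
  \esum_(x in [set: X]) f x = (\sum_(x <- E) f x)%E.
Proof.
move=> uE f0 fE; rewrite fsbig_seq// -esum_fset//.
rewrite [RHS]esum_mkcond; apply: eq_esum => x _.
by case: ifPn => // /negP; rewrite inE /= => /negP/fE.
Qed.

Lemma esum_ge_seq (R : realType) (X : choiceType) (E : seq X)
    (f : X -> \bar R) : uniq E ->
  (\sum_(x <- E) f x <= \esum_(x in [set: X]) f x)%E.
Proof.
by move=> uE; rewrite fsbig_seq//; apply: esum_ge; exists [set` E].
Qed.

Lemma esum_gt_seq (R : realType) (X : choiceType) (f : X -> \bar R)
    (a : \bar R) :
  (a < \esum_(x in [set: X]) f x)%E ->
  exists2 E : seq X, uniq E & (a < \sum_(x <- E) f x)%E.
Proof.
move=> /ereal_sup_gt[_ [Y [finY _] <-]]; rewrite fsbig_finite// => aY.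
by exists (finmap.enum_fset (fset_set Y)); first exact: finmap.fset_uniq.
Qed.

Lemma esumZ_le (R : realType) (X : choiceType) (f : X -> \bar R) (c : R) :
  0 <= c -> (forall x, 0 <= f x)%E ->
  (\esum_(x in [set: X]) (c%:E * f x) <= c%:E * \esum_(x in [set: X]) f x)%E.
Proof.
move=> c0 f0; apply: ge_ereal_sup => _ [Y Yfin <-].
rewrite -ge0_mule_fsumr//; apply: lee_wpmul2l; first by rewrite lee_fin.
by apply: ereal_sup_ubound; exists Y.
Qed.

Lemma esumZ_ge (R : realType) (X : choiceType) (f : X -> \bar R) (c : R) :
  0 <= c -> (forall x, 0 <= f x)%E ->
  (c%:E * (\esum_(x in [set: X]) f x) <= \esum_(x in [set: X]) (c%:E * f x))%E.
Proof.
move=> c0 f0; have cf0 x : (0 <= c%:E * f x)%E by rewrite mule_ge0.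
move: c0; rewrite le_eqVlt => /predU1P[c0|c0].
  by rewrite -c0 mul0e; apply: esum_ge0 => x _; rewrite c0.
rewrite -lee_pdivlMl//; apply: le_trans (esumZ_le _ _) => //.
  by apply: le_esum => x _; rewrite muleA -EFinM mulVf ?mul1e// gt_eqF.
by rewrite invr_ge0 ltW.
Qed.

(** * Mixed strategies and their payoffs *)

Lemma distr_ge0 (X : Type) (p : X -> R) x : distr p -> 0 <= p x.
Proof. by move=> [p0 _]; apply/RleP. Qed.

Lemma distr_sum1 (X : Type) (p : X -> R) : distr p ->
  (\esum_(x in [set: {classic X}]) (p x)%:E = 1)%E.
Proof. by move=> [_ []]. Qed.

Lemma pimix_swap (S T : Type) (pi : S -> T -> bool) p q :
  pimix pi p q = pimix (fun t s => pi s t) q p.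
Proof.
rewrite /pimix (@reindex_esum _ {classic (T * S)%type} {classic (S * T)%type}
  setT setT (fun k => (k.2, k.1))).
  by apply: eq_esum => k _; congr (_ * _)%:E; exact: mulrC.
by split => // [[? ?] [? ?] _ _ [-> ->]//|[x y] _]; exists (y, x).
Qed.

Lemma pimixE (S T : Type) (pi : S -> T -> bool) p q :
  (forall s, 0 <= p s) -> (forall t, 0 <= q t) ->
  pimix pi p q = \esum_(s in [set: {classic S}]) \esum_(t in [set: {classic T}])
    (p s * q t * (pi s t)%:R)%:E.
Proof.
move=> p0 q0; rewrite esum_esum; last first.
  by move=> s t _ _; rewrite lee_fin !mulr_ge0.
rewrite /pimix (@reindex_esum _ ({classic S} * {classic T})%type
  {classic (S * T)%type} (setT `*`` (fun=> setT)) setT id)//.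
by split => // -[x y] _; exists (x, y).
Qed.

(** Meaningful only if the weights on [E] have positive sum. *)
Definition fdistr (X : Type) (E : seq {classic X}) (w : X -> R) : X -> R :=
  fun x => if (x : {classic X}) \in E then w x / \sum_(y <- E) w y else 0.

Lemma fdistr_ge0 (X : Type) (E : seq {classic X}) (w : X -> R) x :
  (forall x, 0 <= w x) -> 0 <= fdistr E w x.
Proof.
by move=> w0; rewrite /fdistr; case: ifP => // _; rewrite divr_ge0 ?sumr_ge0.
Qed.

Lemma distr_fdistr (X : Type) (E : seq {classic X}) (w : X -> R) :
  uniq E -> (forall x, 0 <= w x) -> 0 < \sum_(x <- E) w x ->
  distr (fdistr E w).
Proof.
move=> uE w0 W0; split=> [x|]; first by apply/RleP; exact: fdistr_ge0.
split.
  apply: finite_set_countable; apply: (@sub_finite_set _ _ [set` E]) => //.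
  by move=> x /=; rewrite /fdistr; case: ifP => //; rewrite eqxx.
rewrite (@esum_seq _ _ E)//.
- rewrite sumEFin; congr EFin.
  under eq_big_seq => x xE do rewrite /fdistr xE.
  by rewrite -mulr_suml divff ?gt_eqF.
- by move=> x; rewrite lee_fin fdistr_ge0.
- by move=> x /negbTE; rewrite /fdistr => ->.
Qed.

Lemma pimix_fdistrr (S T : Type) (pi : S -> T -> bool) p
    (F : seq {classic T}) (w : T -> R) :
  uniq F -> (forall s, 0 <= p s) -> (forall t, 0 <= w t) ->
  pimix pi p (fdistr F w) = \esum_(s in [set: {classic S}])
    ((\sum_(t <- F) w t * (pi s t)%:R) / (\sum_(t <- F) w t) * p s)%:E.
Proof.
move=> uF p0 w0; rewrite pimixE// => [|t]; last exact: fdistr_ge0.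
apply: eq_esum => s _; rewrite (@esum_seq _ _ F)//.
- rewrite sumEFin; congr EFin.
  under eq_big_seq => t tF do rewrite /fdistr tF.
  rewrite !mulr_suml; apply: eq_bigr => t _.
  by rewrite -!mulrA mulrC -!mulrA; congr (_ * _); rewrite mulrCA.
- by move=> t; rewrite lee_fin !mulr_ge0// fdistr_ge0.
- by move=> t /negbTE; rewrite /fdistr => ->; rewrite mulr0 mul0r.
Qed.

(** * LNG-free games are minimax *)

(** Normalized, [w] is a mixed strategy, so some [q] holds it below [a]; the payoff is a [q]-average
    over pure columns, which cannot all exceed [a]. *)
Lemma pure_response_below (S T : Type) (pi : S -> T -> bool) (a : R) :
  inhabited T ->
  (ereal_sup [set ereal_inf [set pimix pi p q | q in @distr T]
     | p in @distr S] < a%:E)%E ->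
  forall (E : seq {classic S}), uniq E -> forall w : S -> R,
    (forall s, 0 <= w s) ->
  exists t, \sum_(s <- E) w s * (pi s t)%:R <= a * \sum_(s <- E) w s.
Proof.
move=> [t0] va E uE w w0.
have : 0 <= \sum_(s <- E) w s by rewrite sumr_ge0.
rewrite le_eqVlt => /predU1P[/esym W0|W0].
  exists t0; rewrite W0 mulr0 -[leRHS]W0; apply: ler_sum => s _.
  by rewrite ler_piMr// lern1 leq_b1.
have pd := distr_fdistr uE w0 W0.
have : (ereal_inf [set pimix pi (fdistr E w) q | q in @distr T] < a%:E)%E.
  by apply: le_lt_trans va; apply: ereal_sup_ubound; exists (fdistr E w).
move=> /ereal_inf_lt[_ [q qd <-]].
have q0 t := distr_ge0 t qd; have q1 := distr_sum1 qd.
rewrite pimix_swap pimix_fdistrr//.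
move=> qa; apply/not_existsP => nt.
have {}nt t : a * \sum_(s <- E) w s < \sum_(s <- E) w s * (pi s t)%:R.
  by rewrite ltNge; apply/negP/nt.
move: qa; rewrite ltNge => /negP; apply.
(* A nonnegative payoff exceeds any negative [a]; scaling the sum by [a] needs [0 <= a]. *)
have [a0|a0] := leP 0 a; last first.
  apply: (@le_trans _ _ 0%E); first by rewrite lee_fin ltW.
  apply: esum_ge0 => t _; rewrite lee_fin mulr_ge0// divr_ge0 ?sumr_ge0// => s _.
  by rewrite mulr_ge0.
rewrite -[leLHS]mule1 -q1.
apply: le_trans (esumZ_ge _ _) _ => //; apply: le_esum => t _.
by rewrite -EFinM lee_fin ler_wpM2r// ler_pdivlMr// ltW.
Qed.

Lemma pure_response_above (S T : Type) (pi : S -> T -> bool) (b : R) :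
  inhabited S ->
  (b%:E < ereal_inf [set ereal_sup [set pimix pi p q | p in @distr S]
     | q in @distr T])%E ->
  forall (F : seq {classic T}), uniq F -> forall w : T -> R,
    (forall t, 0 <= w t) ->
  exists s, b * \sum_(t <- F) w t <= \sum_(t <- F) w t * (pi s t)%:R.
Proof.
move=> [s0] bv F uF w w0.
have : 0 <= \sum_(t <- F) w t by rewrite sumr_ge0.
rewrite le_eqVlt => /predU1P[/esym W0|W0].
  by exists s0; rewrite W0 mulr0 sumr_ge0// => t _; rewrite mulr_ge0.
have qd := distr_fdistr uF w0 W0.
have : (b%:E < ereal_sup [set pimix pi p (fdistr F w) | p in @distr S])%E.
  by apply: (lt_le_trans bv); apply: ereal_inf_lbound; exists (fdistr F w).
move=> /ereal_sup_gt[_ [p pd <-]].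
have p0 s := distr_ge0 s pd; have p1 := distr_sum1 pd.
rewrite pimix_fdistrr//.
move=> qa; apply/not_existsP => ns.
have {}ns s : \sum_(t <- F) w t * (pi s t)%:R < b * \sum_(t <- F) w t.
  by rewrite ltNge; apply/negP/ns.
(* The assumed strict bound at [s0] gives the sign that scaling by [b] requires. *)
have b0 : 0 <= b.
  rewrite -(pmulr_lge0 _ W0) ltW//; apply: le_lt_trans (ns s0).
  by apply: sumr_ge0 => t _; rewrite mulr_ge0.
move: qa; rewrite ltNge => /negP; apply.
rewrite -[leRHS]mule1 -p1.
apply: le_trans (esumZ_le _ _) => //; apply: le_esum => s _.
by rewrite -EFinM lee_fin ler_wpM2r// ler_pdivrMr// ltW.
Qed.

Lemma ereal_gap (R : realType) (v w : \bar R) : (v < w)%E ->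
  exists a b : R, [/\ (v < a%:E)%E, a < b & (b%:E < w)%E].
Proof.
case: v w => [x| |] [y| |]//.
- rewrite lte_fin => xy; exists (x + (y - x) / 3), (x + 2 * ((y - x) / 3)).
  by rewrite !lte_fin; split; lra.
- by move=> _; exists (x + 1), (x + 2); rewrite lte_fin ltry; split => //; lra.
- by move=> _; exists (y - 2), (y - 1); rewrite lte_fin ltNyr; split => //; lra.
- by move=> _; exists 0, 1; rewrite ltry ltNyr ltr01.
Qed.

Lemma minimax_of_LNG_free (S T : Type) (pi : S -> T -> bool) :
  inhabited S -> inhabited T -> LNG_free pi -> minimax pi.
Proof.
move=> iS iT free; apply/eqP; rewrite eq_le; apply/andP; split.
  apply: ge_ereal_sup => _ [p pd <-]; apply: le_ereal_inf_tmp => _ [q qd <-].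
  apply: (@le_trans _ _ (pimix pi p q)).
    by apply: ereal_inf_lbound; exists q.
  by apply: ereal_sup_ubound; exists p.
rewrite leNgt; apply/negP => /ereal_gap[a [b [va ab bw]]]; apply: free.
(* Each use of [finite_minimax] loses [e]; thirds leave a positive gap. *)
pose e := (b - a) / 3.
have e0 : 0 < e by rewrite divr_gt0// subr_gt0.
have gap : a + e < b - e by rewrite /e; lra.
have [||s [t H]] := @LNG_pattern_of_gap R {classic S} {classic T} pi _ _ gap.
- move=> E; have := pure_response_below iT va (undup_uniq E).
  move=> /(@finite_minimax _ {classic S} {classic T} _ _ _ _ e0)[q q0 qP].
  by exists q => // s sE; apply: qP; rewrite mem_undup.
- move=> F.
  (* The transposed game with complemented payoff turns the upper bound [1 - b + e] into the lower
     bound [b - e]. *)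
  have [|p p0 pP] := @finite_minimax R {classic T} {classic S}
    (fun t s => ~~ pi s t) (1 - b) e (undup F) e0.
    move=> w w0; have [s Hs] := pure_response_above iS bw (undup_uniq F) w0.
    exists s.
    have -> : \sum_(t <- undup F) w t * (~~ pi s t)%:R =
        \sum_(t <- undup F) w t - \sum_(t <- undup F) w t * (pi s t)%:R.
      rewrite -sumrB; apply: eq_bigr => t _.
      by case: (pi s t); rewrite /= ?mulr1 ?mulr0 ?subrr ?subr0.
    by rewrite mulrBl mul1r lerB.
  exists p => // t tF; have := pP t; rewrite mem_undup => /(_ tF).
  rewrite (_ : (fun s => ~~ pi s t) = predC (pi^~ t))// freqC//; lra.
by have [injs injt] := LNG_pattern_inj H; exists s, t.
Qed.

(** * The larger number game is not minimax *)

Lemma distr_seq (X : Type) (p : X -> R) (e : R) : distr p -> 0 < e ->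
  exists2 E : seq {classic X}, uniq E & 1 - e < \sum_(x <- E) p x.
Proof.
move=> pd e0; have p1 := distr_sum1 pd.
have [|E uE] := @esum_gt_seq _ {classic X} (fun x => (p x)%:E) (1 - e)%:E.
  by rewrite p1 lte_fin; lra.
by rewrite sumEFin lte_fin; exists E.
Qed.

Lemma pimix_dirac (S T : Type) (pi : S -> T -> bool) p t :
  (forall s, 0 <= p s) ->
  pimix pi p (fdistr [:: t] (fun=> 1)) =
  \esum_(s in [set: {classic S}]) (p s * (pi s t)%:R)%:E.
Proof.
move=> p0; rewrite pimix_fdistrr//; apply: eq_esum => s _.
by rewrite !big_seq1 mul1r divr1 mulrC.
Qed.

Lemma distr_dirac (X : Type) (x : X) : distr (fdistr [:: x] (fun=> 1)).
Proof. by apply: distr_fdistr => //; rewrite big_seq1. Qed.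

Lemma seq_index_bound (X : Type) (s : nat -> X) (E : seq {classic X}) :
  (forall x, exists i, s i = x) ->
  exists n, forall x, x \in E -> exists2 i, (i < n)%N & s i = x.
Proof.
move=> surj; elim: E => [|x E [n IH]]; first by exists 0%N.
have [i si] := surj x; exists (maxn i.+1 n) => y.
rewrite in_cons => /predU1P[->|/IH[j jn sj]].
  by exists i => //; rewrite leq_maxl.
by exists j => //; rewrite (leq_trans jn)// leq_maxr.
Qed.

(** Each [p] has mass above [2 / 3] on rows [s i] with [i < n], all losing to [t n]; each [q] has
    such mass on columns [t j] with [j < n], all beaten by [s n]. So the values are at most [1 / 3]
    and at least [2 / 3]. *)
Lemma LNG_not_minimax (S T : Type) (pi : S -> T -> bool)
    (s : nat -> S) (t : nat -> T) :
  (forall x, exists i, s i = x) -> (forall y, exists j, t j = y) ->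
  (forall i j, pi (s i) (t j) = (j <= i)%N) -> ~ minimax pi.
Proof.
move=> surjs surjt H; rewrite /minimax => eq_vw.
have third : 0 < 3^-1 :> R by rewrite invr_gt0.
have v_le : (ereal_sup [set ereal_inf [set pimix pi p q | q in @distr T]
     | p in @distr S] <= 3^-1%R%:E)%E.
  apply: ge_ereal_sup => _ [p pd <-].
  have p0 x := distr_ge0 x pd; have p1 := distr_sum1 pd.
  have [E uE pE] := distr_seq pd third.
  have [n En] := seq_index_bound E surjs.
  apply: ge_ereal_inf; exists (pimix pi p (fdistr [:: t n] (fun=> 1))).
    by exists (fdistr [:: t n] (fun=> 1)); first exact: distr_dirac.
  rewrite pimix_dirac//.
  (* The payoff is bounded above through the complementary probability of losing, which a finite
     partial sum bounds below. *)
  have : (\esum_(x in [set: {classic S}]) (p x * (pi x (t n))%:R)%:E +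
     \esum_(x in [set: {classic S}]) (p x * (~~ pi x (t n))%:R)%:E = 1%:E)%E.
    rewrite -esumD; do ?by move=> x _; rewrite lee_fin mulr_ge0.
    rewrite -p1; apply: eq_esum => x _.
    by rewrite -EFinD -mulrDr; case: (pi _ _); rewrite ?addr0 ?add0r mulr1.
  have := @esum_ge_seq _ _ E (fun x => (p x * (~~ pi x (t n))%:R)%:E) uE.
  have -> : (\sum_(x <- E) (p x * (~~ pi x (t n))%:R)%:E)%E =
      (\sum_(x <- E) p x)%:E.
    rewrite sumEFin; congr EFin; apply: eq_big_seq => x /En[i lin <-].
    by rewrite H leqNgt lin mulr1.
  have : (0 <= \esum_(x in [set: {classic S}]) (p x * (pi x (t n))%:R)%:E)%E.
    by apply: esum_ge0 => x _; rewrite lee_fin mulr_ge0.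
  case: (\esum_(_ in _) _) => [u| |]// _; case: (\esum_(_ in _) _) => [u'| |]//.
  by rewrite lee_fin -EFinD => ? [?]; rewrite lee_fin; lra.
have w_ge : ((1 - 3^-1)%R%:E <= ereal_inf [set ereal_sup
    [set pimix pi p q | p in @distr S] | q in @distr T])%E.
  apply: le_ereal_inf_tmp => _ [q qd <-]; have q0 y := distr_ge0 y qd.
  have [F uF qF] := distr_seq qd third.
  have [n Fn] := seq_index_bound F surjt.
  apply: (@le_trans _ _ (pimix pi (fdistr [:: s n] (fun=> 1)) q)); last first.
    apply: ereal_sup_ubound; exists (fdistr [:: s n] (fun=> 1)) => //.
    exact: distr_dirac.
  rewrite pimix_swap pimix_dirac//; apply: le_trans (esum_ge_seq _ uF).
  rewrite sumEFin lee_fin (_ : \sum_(y <- F) _ = \sum_(y <- F) q y); last first.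
    by apply: eq_big_seq => y /Fn[j /ltnW jn <-]; rewrite H jn mulr1.
  exact: ltW.
rewrite -eq_vw in w_ge; have := le_trans w_ge v_le.
by rewrite lee_fin; lra.
Qed.

Theorem theorem3p1 (S T : Type) (pi : S -> T -> bool) :
  inhabited S -> inhabited T ->
  (totally_minimax pi <-> LNG_free pi).
Proof.
move=> _ _; split=> [mm [s [t [_ [_ H]]]]|free A B [x Ax] [y By]].
  (* Restricting to the ranges makes both sequences surjective, as [LNG_not_minimax] requires. *)
  pose s' i : {x | range s x} := exist _ (s i) (imageT s i).
  pose t' i : {x | range t x} := exist _ (t i) (imageT t i).
  apply: (@LNG_not_minimax _ _ (@subgame S T pi (range s) (range t)) s' t').
  - by move=> [x sx]; have [i _ six] := sx; exists i; apply: eq_exist.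
  - by move=> [x sx]; have [i _ six] := sx; exists i; apply: eq_exist.
  - exact: H.
  - by apply: mm; [exists (s 0%N)|exists (t 0%N)]; exact: imageT.
apply: minimax_of_LNG_free.
- by constructor; exists x.
- by constructor; exists y.
move=> [s [t [_ [_ H]]]]; apply: free.
exists (fun i => proj1_sig (s i)), (fun i => proj1_sig (t i)).
by have [] := @LNG_pattern_inj _ _ pi (fun i => proj1_sig (s i))
  (fun i => proj1_sig (t i)) H.
Qed.
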